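(* Let $(X,\mu,T)$ be a nonsingular dynamical system such that $T\times T$ is conservative ergodic (on $(X\times X,\mu\times\mu)$), and let $d$ be a $\mu$-compatible metric on $X$. Let $G=\{d(x,y):x,y\in X\}$ and $$\mathcal{N}=\{r:\ \text{for a.e. }(x,y)\in X^2\text{ there is a strictly increasing sequence }\{n_k\}\text{ with }d(T^{n_k}x,T^{n_k}y)\to r\}.$$ Then $\overline{G}\subset\mathcal{N}$. In particular, $T$ is Li-Yorke M-sensitive and W-measurably sensitive.
   Context: A nonsingular dynamical system $(X,\mu,T)$ consists of a standard Borel space $X$ with a $\sigma$-finite nonatomic (nonzero) measure $\mu$ and a measurable map $T:X\to X$ such that $\mu(A)=0$ iff $\mu(T^{-1}A)=0$ for measurable $A$. A nonsingular map $S$ of $(Y,\nu)$ is conservative if for every $A$ with $\nu(A)>0$ there is $n>0$ with $\nu(S^{-n}A\cap A)>0$, and ergodic if $S^{-1}(A)=A$ implies $\nu(A)=0$ or $\nu(Y\setminus A)=0$. $\overline{G}$ is the closure of $G$ in $\mathbb{R}$. All metrics on $X$ are assumed Borel measurable on $X\times X$ and bounded by $1$. A metric $d$ is $\mu$-compatible if every nonempty open $d$-ball has positive $\mu$-measure. A pair $(x,y)$ is a Li-Yorke pair for $d$ if $\liminf_{n\to\infty}d(T^nx,T^ny)=0$ and $\limsup_{n\to\infty}d(T^nx,T^ny)>0$. $T$ is Li-Yorke M-sensitive if for every $\mu$-compatible metric $d$ the set of Li-Yorke pairs for $d$ has full $\mu\times\mu$-measure. $T$ is W-measurably sensitive with respect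 to $d$ if there is $\delta>0$ such that for each $x\in X$, $\limsup_{n\to\infty}d(T^nx,T^ny)>\delta$ for a.e. $y\in X$; it is W-measurably sensitive if this holds for every $\mu$-compatible metric $d$. *)

(* Defs.v *)
From HB Require Import structures.
From mathcomp Require Import all_boot all_order all_algebra.
From mathcomp Require Import all_classical all_reals all_analysis.

Set Implicit Arguments.
Unset Strict Implicit.
Unset Printing Implicit Defensive.

Import Order.TTheory GRing.Theory Num.Theory.
Import numFieldNormedType.Exports.

Local Open Scope classical_set_scope.
Local Open Scope ring_scope.

Definition polish (R : realType) (P : metricType R) : Prop :=
  (forall u : nat -> P, cauchy (u @ \oo) -> exists l : P, u @ \oo --> l) /\
  (exists2 D : set P, countable D & dense D).

(* Borel isomorphic to a Polish space; <<s open >> is the Borel sigma-algebra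
   of P. *)
Definition standard_borel (R : realType) (disp : measure_display)
    (X : measurableType disp) : Prop :=
  exists (P : metricType R) (f : X -> P),
    [/\ polish P, bijective f &
        forall A : set X, measurable A <-> <<s (@open P) >> (f @` A)].

Section dynamics.
Context (disp : measure_display) (X : measurableType disp) (R : realType).
Local Open Scope ereal_scope.

Definition nonatomic (mu : {measure set X -> \bar R}) : Prop :=
  forall A : set X, measurable A -> 0 < mu A ->
    exists B : set X, [/\ measurable B, B `<=` A, 0 < mu B & 0 < mu (A `\` B)].

Definition nonsingular (mu : {measure set X -> \bar R}) (T : X -> X) : Prop :=
  measurable_fun setT T /\
  (forall A : set X, measurable A -> mu A = 0 <-> mu (T @^-1` A) = 0).

Definition conservative (mu : {measure set X -> \bar R}) (S : X -> X) : Prop :=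
  forall A : set X, measurable A -> 0 < mu A ->
    exists n : nat, (0 < n)%N /\ 0 < mu (iter n S @^-1` A `&` A).

Definition ergodic (mu : {measure set X -> \bar R}) (S : X -> X) : Prop :=
  forall A : set X, measurable A -> S @^-1` A = A ->
    mu A = 0 \/ mu (~` A) = 0.

Record nonsingular_dynamical_system
    (mu : {sigma_finite_measure set X -> \bar R}) (T : X -> X) : Prop := {
  nds_standard_borel : standard_borel R X ;
  nds_nonatomic : nonatomic mu ;
  nds_nonzero : mu setT != 0 ;
  nds_nonsingular : nonsingular mu T }.

Definition prod_self (T : X -> X) : X * X -> X * X :=
  fun p => (T p.1, T p.2).

End dynamics.

Section metrics.
Context (disp : measure_display) (X : measurableType disp) (R : realType).

Record is_metric (d : X -> X -> R) : Prop := {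
  metric_ge0 : forall x y, 0 <= d x y ;
  metric_eq0 : forall x y, d x y = 0 <-> x = y ;
  metric_sym : forall x y, d x y = d y x ;
  metric_triangle : forall x y z, d x z <= d x y + d y z }.

(* The standing assumptions on metrics (Borel on X * X, bounded by 1) are part
   of compatibility. *)
Record compatible_metric (mu : {measure set X -> \bar R}) (d : X -> X -> R)
    : Prop := {
  compatible_is_metric : is_metric d ;
  compatible_measurable : measurable_fun setT (fun p : X * X => d p.1 p.2) ;
  compatible_le1 : forall x y, d x y <= 1 ;
  compatible_ball : forall (x : X) (r : R), 0 < r ->
    (0 < mu [set y | (d x y < r)%R])%E }.

Definition orbit_dist (T : X -> X) (d : X -> X -> R) (x y : X) : nat -> R :=
  fun n => d (iter n T x) (iter n T y).

Definition li_yorke_pair (T : X -> X) (d : X -> X -> R) (x y : X) : Prop :=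
  limn_einf (EFin \o orbit_dist T d x y) = 0%E /\
  (0 < limn_esup (EFin \o orbit_dist T d x y))%E.

Definition li_yorke_M_sensitive
    (mu : {sigma_finite_measure set X -> \bar R}) (T : X -> X) : Prop :=
  forall d : X -> X -> R, compatible_metric mu d ->
    {ae (mu \x mu)%E, forall p : X * X, li_yorke_pair T d p.1 p.2}.

Definition W_measurably_sensitive_wrt
    (mu : {measure set X -> \bar R}) (T : X -> X) (d : X -> X -> R) : Prop :=
  exists2 delta : R, 0 < delta &
    forall x : X, {ae mu, forall y : X,
      (delta%:E < limn_esup (EFin \o orbit_dist T d x y))%E}.

Definition W_measurably_sensitive
    (mu : {measure set X -> \bar R}) (T : X -> X) : Prop :=
  forall d : X -> X -> R, compatible_metric mu d ->
    W_measurably_sensitive_wrt mu T d.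

Definition dist_values (d : X -> X -> R) : set R :=
  range (fun p : X * X => d p.1 p.2).

Definition ae_limit_values (mu : {sigma_finite_measure set X -> \bar R})
    (T : X -> X) (d : X -> X -> R) : set R :=
  [set r | {ae (mu \x mu)%E, forall p : X * X,
     exists2 n_ : nat -> nat, increasing_seq n_ &
       (orbit_dist T d p.1 p.2 \o n_) @ \oo --> r}].

End metrics.

(* Main.v *)
(** A conservative ergodic map visits every set of positive measure infinitely
    often, from almost every point. For [r] in the closure of [G], the set of
    pairs at distance close to [r] contains a product of two balls, hence has
    positive measure, so the orbit of almost every pair under [T x T]
    accumulates at distance [r]. Li-Yorke pairs arise from [r = 0] and from
    any positive distance. For W-sensitivity, which concerns every [x], two
    points whose orbits stay close to that of [x] stay close to each other, so
    the square of the set of such points is null, hence the set itself is. *)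

Require Import Defs.
From HB Require Import structures.
From mathcomp Require Import all_boot all_order all_algebra.
From mathcomp Require Import all_classical all_reals all_analysis.
From mathcomp Require Import lra.

Set Implicit Arguments.
Unset Strict Implicit.
Unset Printing Implicit Defensive.

Import Order.TTheory GRing.Theory Num.Theory.
Import numFieldNormedType.Exports.

Local Open Scope classical_set_scope.
Local Open Scope ring_scope.

Lemma iter_measurable (disp : measure_display) (Y : measurableType disp)
    (S : Y -> Y) (n : nat) :
  measurable_fun setT S -> measurable_fun setT (iter n S).
Proof.
move=> mS; elim: n => [|n IHn]; first exact: measurable_id.
exact: (measurableT_comp mS IHn).
Qed.

Lemma iter_prod_self (disp : measure_display) (X : measurableType disp)
    (T : X -> X) (n : nat) (p : X * X) :
  iter n (prod_self T) p = (iter n T p.1, iter n T p.2).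
Proof. by elim: n => [|n /= ->]; first exact: surjective_pairing. Qed.

Lemma prod_self_measurable (disp : measure_display) (X : measurableType disp)
    (T : X -> X) :
  measurable_fun setT T -> measurable_fun setT (prod_self T).
Proof.
move=> mT; apply/measurable_fun_pairP; split.
  exact: (measurableT_comp mT measurable_fst).
exact: (measurableT_comp mT measurable_snd).
Qed.

(** The set [B] of points with infinitely many visits to [A] is exactly invariant, so ergodicity
    makes it null or conull. If it were null, [A] would be covered by [B] and countably many null
    sets of points having a last visit, against [0 < mu A]. *)
Lemma ae_visits_infinitely_often (R : realType) (disp : measure_display)
    (Y : measurableType disp) (mu : {measure set Y -> \bar R})
    (S : Y -> Y) (A : set Y) :
  measurable_fun setT S -> conservative mu S -> ergodic mu S ->
  measurable A -> (0 < mu A)%E ->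
  {ae mu, forall p, forall N, exists2 n, (N <= n)%N & A (iter n S p)}.
Proof.
move=> mS cons erg mA muA0.
have mSA n : measurable (iter n S @^-1` A).
  by rewrite -[X in measurable X]setTI; exact: iter_measurable.
pose B := \bigcap_N \bigcup_(n >= N) (iter n S @^-1` A).
have mB : measurable B.
  by apply: bigcapT_measurable => N; exact: bigcup_measurable.
have SB : S @^-1` B = B.
  apply/seteqP; split => p Bp N _.
    have [n /= Nn An] := Bp N I.
    exists n.+1; first exact: leqW.
    by rewrite /preimage/mkset iterSr.
  (* The bound [N.+1] forces the visit time to be positive, so that it can be lowered by one. *)
  have [[//|n] /= Nn An] := Bp N.+1 I.
  by exists n => //=; rewrite -iterSr.
have [B0|Bc0] := erg B mB SB; last first.
  exists (~` B); split => //; first exact: measurableC.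
  by apply: subsetC => p Bp /= N; have [n /= Nn An] := Bp N I; exists n.
(* The set of points whose last visit to [A] occurs at time [n] never returns
   to itself. *)
pose L n := (iter n S @^-1` A) `\` \bigcup_(m >= n.+1) (iter m S @^-1` A).
have mL n : measurable (L n).
  by apply: measurableD => //; exact: bigcup_measurable.
have L0 n : mu (L n) = 0%E.
  apply/eqP; apply: contrapT => /negP Ln0.
  have [|k [k0]] := cons _ (mL n); first by rewrite lt0e Ln0 measure_ge0.
  suff -> : iter k S @^-1` L n `&` L n = set0 by rewrite measure0 ltxx.
  apply/seteqP; split => // p [/= [Akn _] [_ +]]; apply.
  by exists (n + k)%N => /=; rewrite ?iterD// -[n.+1]addn1 leq_add2l.
suff A0 : mu A = 0%E by rewrite A0 ltxx in muA0.
(* A point of [A] outside [B] has boundedly many visit times, time 0 among them, hence a greatest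
   one. *)
have ABL : A `<=` B `|` \bigcup_n L n.
  move=> p Ap; have [Bp|nBp] := pselect (B p); [by left|right].
  have [N nN] : exists N, forall n, (N <= n)%N -> ~ A (iter n S p).
    apply: contrapT => h; apply: nBp => N _; apply: contrapT => h'.
    by apply: h; exists N => n Nn An; apply: h'; exists n.
  have Pb n : `[< A (iter n S p) >] -> (n <= N)%N.
    by move=> /asboolP An; rewrite leqNgt; apply/negP => /ltnW /nN.
  have P0 : exists n, `[< A (iter n S p) >] by exists 0%N; exact/asboolP.
  case: (ex_maxnP P0 Pb) => n /asboolP An nmax; exists n => //; split => //.
  by case=> m /= nm Am; have := leq_trans nm (nmax m (asboolT Am)); rewrite ltnn.
apply/(negligibleP mu mA); apply: negligibleS ABL _.
apply: negligibleU; first exact/(negligibleP mu mB).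
by apply: negligible_bigcup => n; apply/(negligibleP mu (mL n)); exact: L0.
Qed.

Lemma limn_esup_ge_frequently (R : realType) (u : (\bar R)^nat) (a : \bar R) :
  (forall N, exists2 n, (N <= n)%N & (a <= u n)%E) -> (a <= limn_esup u)%E.
Proof.
move=> ua; apply: le_ereal_inf_tmp => _ [V [N _ NV] <-].
have [n Nn an] := ua N; apply: (le_trans an).
by apply: ereal_sup_ubound; exists n => //; exact: NV.
Qed.

(** The limit inferior unfolds to minus the limit superior of [- u]: nonnegativity bounds the latter
    above by 0, and the frequent times where [u] is at most [e] bound it below by [- e]. *)
Lemma limn_einf_eq0 (R : realType) (u : R^nat) :
  (forall n, 0 <= u n) -> cluster (u @ \oo) 0 ->
  limn_einf (EFin \o u) = 0%E.
Proof.
move=> u0 /cluster_eventuallyP cu; rewrite /limn_einf.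
suff -> : limn_esup (\- (EFin \o u))%E = 0%E by rewrite oppe0.
apply/eqP; rewrite eq_le; apply/andP; split.
  apply: ereal_inf_le; exists (ereal_sup [set (- (EFin \o u) n)%E | n in setT]).
    by exists setT => //; exact: filterT.
  by apply: ge_ereal_sup => _ [n _ <-] /=; rewrite lee_fin oppr_le0.
apply/lee_addgt0Pr => e e0; rewrite -leeBlDr//.
apply: limn_esup_ge_frequently => N; have [n Nn] := cu e N e0.
rewrite sub0r normrN ger0_norm// => une; exists n => //=.
by rewrite lee_fin sub0r lerN2.
Qed.

(** The margin [r - a] serves as tolerance: values within it of [r] are at least [a]. *)
Lemma limn_esup_ge_cluster (R : realType) (u : R^nat) (r a : R) :
  cluster (u @ \oo) r -> a < r -> (a%:E <= limn_esup (EFin \o u))%E.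
Proof.
move=> /cluster_eventuallyP cu ar; apply: limn_esup_ge_frequently => N.
have [|n Nn] := cu (r - a) N; first by rewrite subr_gt0.
move=> /(le_trans (ler_norm _)); rewrite lerD2l lerN2 => aun.
by exists n => //=; rewrite lee_fin.
Qed.

Section sensitivity.
Variables (R : realType) (disp : measure_display) (X : measurableType disp).
Variable mu : {sigma_finite_measure set X -> \bar R}.
Local Notation mu2 := (mu \x mu)%E.

Lemma section_measurable (d : X -> X -> R) (x : X) :
  measurable_fun setT (fun p : X * X => d p.1 p.2) -> measurable_fun setT (d x).
Proof. by move=> md; exact: (measurableT_comp md (pair1_measurable x)). Qed.

Lemma dist_near_measurable (d : X -> X -> R) (r e : R) :
  compatible_metric mu d ->
  measurable [set p : X * X | `|r - d p.1 p.2| < e].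
Proof.
move=> dc.
rewrite (_ : mkset _ = (fun p : X * X => d p.1 p.2) @^-1` `]r - e, r + e[).
  by rewrite -[X in measurable X]setTI; exact: (compatible_measurable dc).
by apply/seteqP; split => p /=; rewrite in_itv/= ltr_distlC.
Qed.

Lemma dist_near_gt0 (d : X -> X -> R) (r e : R) :
  compatible_metric mu d -> closure (dist_values d) r -> 0 < e ->
  (0 < mu2 [set p : X * X | (`|r - d p.1 p.2| < e)%R])%E.
Proof.
move=> dc clr e0; have dm := compatible_is_metric dc.
(* Half of [e] goes to approximating [r] by a value [d x y]; moving each of [x] and [y] by less than
   [e / 4] uses up the other half. *)
have [|_ [[[x y] _ <-] /=]] := clr (ball r (e / 2)).
  by apply: nbhsx_ballx; rewrite divr_gt0.
rewrite /ball/= => rxy.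
pose B z := [set w | d z w < e / 4].
have mB z : measurable (B z).
  rewrite (_ : B z = d z @^-1` `]-oo, (e / 4)[).
    rewrite -[X in measurable X]setTI.
    by apply: (section_measurable _ (compatible_measurable dc)).
  by apply/seteqP; split => w /=; rewrite in_itv.
have B0 z : (0 < mu (B z))%E by apply: (compatible_ball dc); rewrite divr_gt0.
apply: (@lt_le_trans _ _ (mu2 (B x `*` B y))).
  by rewrite product_measure1E//; apply: mule_gt0; exact: B0.
apply: le_measure; rewrite ?inE; [exact: measurableX|exact: dist_near_measurable|].
move=> [a b] [/= Ba Bb]; rewrite /B/= in Ba Bb.
(* The first two inequalities bound [d x y] by [d a b], the last two bound [d a b] by [d x y], each
   up to an error below [e / 2]. *)
have t1 := Defs.metric_triangle dm x a y.
have t2 := Defs.metric_triangle dm a b y.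
have t3 := Defs.metric_triangle dm a x b.
have t4 := Defs.metric_triangle dm x y b.
rewrite (Defs.metric_sym dm b y) in t2; rewrite (Defs.metric_sym dm a x) in t3.
by move: rxy; rewrite !ltr_norml => /andP[? ?]; apply/andP; split; lra.
Qed.

Variable T : X -> X.
Hypothesis mT : measurable_fun setT T.
Hypothesis cons : conservative mu2 (prod_self T).
Hypothesis erg : ergodic mu2 (prod_self T).

(** Tolerances [k.+1%:R^-1] suffice, so only countably many null sets have to be discarded. *)
Lemma closure_dist_values_ae_cluster (d : X -> X -> R) (r : R) :
  compatible_metric mu d -> closure (dist_values d) r ->
  {ae mu2, forall p, cluster (orbit_dist T d p.1 p.2 @ \oo) r}.
Proof.
move=> dc clr.
have : {ae mu2, forall p, forall k N, exists2 n, (N <= n)%N &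
    `|r - orbit_dist T d p.1 p.2 n| < k.+1%:R^-1}.
  apply: ae_foralln => k.
  have := ae_visits_infinitely_often (prod_self_measurable mT) cons erg
    (dist_near_measurable r k.+1%:R^-1 dc) (dist_near_gt0 dc clr _).
  rewrite invr_gt0 ltr0n => /(_ isT).
  apply: filterS => p /= h N; have [n Nn] := h N.
  by rewrite iter_prod_self => ?; exists n.
apply: filterS => p h; apply/cluster_eventuallyP => e N e0.
have [k _ /(_ k (leqnn k)) ke] := near_infty_natSinv_lt (PosNum e0).
have [n Nn ne] := h k N; exists n => //.
by apply/ltW/(lt_trans ne).
Qed.

(** Taking sections of the previous result would give only almost every [x]. Comparing two points
    through [x] reaches every [x], with a bound independent of it. *)
Lemma ae_limn_esup_gt (d : X -> X -> R) (r : R) :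
  compatible_metric mu d -> closure (dist_values d) r -> 0 < r ->
  forall x : X, {ae mu, forall y : X,
    ((r / 8)%:E < limn_esup (EFin \o orbit_dist T d x y))%E}.
Proof.
move=> dc clr r0 x; have dm := compatible_is_metric dc.
pose E N := [set y | forall n, (N <= n)%N -> orbit_dist T d x y n <= r / 4].
have mE N : measurable (E N).
  rewrite (_ : E N =
      \bigcap_(n >= N) (orbit_dist T d x ^~ n @^-1` `]-oo, (r / 4)])).
    apply: bigcap_measurable => [|n _]; first by exists N => /=.
    rewrite -[X in measurable X]setTI.
    apply: (measurableT_comp (section_measurable _ (compatible_measurable dc))) => //.
    exact: iter_measurable.
  by apply/seteqP; split => y /= h n Nn; have := h n Nn; rewrite /= in_itv.
(* The points of [E N] stay within [r / 2] of each other, whereas almost every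
   pair comes back close to distance [r]. *)
have EE0 N : mu2 (E N `*` E N) = 0%E.
  apply/(negligibleP _ (measurableX (mE N) (mE N))).
  apply: negligibleS (closure_dist_values_ae_cluster dc clr) => -[y z] /= [Ey Ez].
  move=> /cluster_eventuallyP cyz.
  (* Tolerance [r / 4] forces a distance of at least [3 r / 4] at some time past [N], above the
     [r / 2] allowed by passing through [x]. *)
  have [|n Nn] := cyz (r / 4) N; first by rewrite divr_gt0.
  move: (Ey n Nn) (Ez n Nn); rewrite /orbit_dist => Eyn Ezn.
  have := Defs.metric_triangle dm (iter n T y) (iter n T x) (iter n T z).
  rewrite (Defs.metric_sym dm (iter n T y) (iter n T x)) ler_norml => t /andP[_].
  by lra.
have E0 N : mu (E N) = 0%E.
  have := EE0 N; rewrite product_measure1E; [|exact: mE..].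
  by move/eqP; rewrite mule_eq0 orbb => /eqP.
apply: (@negligibleS _ _ _ mu (\bigcup_N E N)); last first.
  by apply: negligible_bigcup => N; apply/(negligibleP mu (mE N)); exact: E0.
(* A point outside every [E N] exceeds [r / 4] infinitely often, so its limit superior is at least
   [r / 4]; the smaller constant [r / 8] makes the inequality strict. *)
move=> y /= /negP; rewrite -leNgt => ley; apply: contrapT => nE.
have : ((r / 4)%:E <= limn_esup (EFin \o orbit_dist T d x y))%E.
  apply: limn_esup_ge_frequently => N; apply: contrapT => h; apply: nE.
  exists N => // n Nn; rewrite leNgt; apply/negP => lt; apply: h.
  by exists n => //=; rewrite lee_fin ltW.
by move=> /le_trans /(_ ley); rewrite lee_fin; lra.
Qed.

End sensitivity.

(** Splitting the whole space into two pieces of positive measure yields two distinct points. *)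
Lemma nonatomic_dist_values_gt0 (R : realType) (disp : measure_display)
    (X : measurableType disp) (mu : {measure set X -> \bar R})
    (d : X -> X -> R) :
  nonatomic mu -> mu setT != 0%E -> is_metric d ->
  exists2 r, dist_values d r & 0 < r.
Proof.
move=> na mu0 dm.
have [|B [mB _ B0 Bc0]] := na setT measurableT.
  by rewrite lt0e mu0 measure_ge0.
have [x Bx] : B !=set0.
  by apply/set0P/eqP => e; rewrite e measure0 ltxx in B0.
have [y [_ nBy]] : setT `\` B !=set0.
  by apply/set0P/eqP => e; rewrite e measure0 ltxx in Bc0.
exists (d x y); first by exists (x, y).
rewrite lt_neqAle (Defs.metric_ge0 dm) andbT; apply/eqP => /esym/(Defs.metric_eq0 dm) xy.
by apply: nBy; rewrite -xy.
Qed.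

Theorem corollary3p2 (R : realType) (disp : measure_display)
    (X : measurableType disp) (mu : {sigma_finite_measure set X -> \bar R})
    (T : X -> X) (d : X -> X -> R) :
  nonsingular_dynamical_system mu T ->
  conservative (mu \x mu)%E (prod_self T) ->
  ergodic (mu \x mu)%E (prod_self T) ->
  compatible_metric mu d ->
  [/\ closure (dist_values d) `<=` ae_limit_values mu T d,
      li_yorke_M_sensitive mu T &
      W_measurably_sensitive mu T].
Proof.
move=> [_ na mu0 [mT _]] cons erg dc; split.
- move=> r clr.
  apply: filterS (closure_dist_values_ae_cluster mT cons erg dc clr) => p.
  by move/cluster_eventually_cvg.
- move=> d' dc'; have dm' := compatible_is_metric dc'.
  have [r Gr r0] := nonatomic_dist_values_gt0 na mu0 dm'.
  have G0 : dist_values d' 0.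
    have [[x y] _ _] := Gr.
    by exists (x, x) => //=; exact/(Defs.metric_eq0 dm').
  (* Cluster value 0 gives the limit inferior, cluster value [r] the limit superior; [r / 2] is a
     positive number strictly below [r], as [limn_esup_ge_cluster] asks. *)
  apply: filterS2
    (closure_dist_values_ae_cluster mT cons erg dc' (subset_closure G0))
    (closure_dist_values_ae_cluster mT cons erg dc' (subset_closure Gr)) => p c0 cr.
  split; first by apply: limn_einf_eq0 => // n; exact: (Defs.metric_ge0 dm').
  apply: (@lt_le_trans _ _ (r / 2)%:E); first by rewrite lte_fin divr_gt0.
  by apply: (limn_esup_ge_cluster cr); rewrite ltr_pdivrMr// ltr_pMr// ltr1n.
- move=> d' dc'.
  have [r Gr r0] := nonatomic_dist_values_gt0 na mu0 (compatible_is_metric dc').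
  exists (r / 8); first by rewrite divr_gt0.
  exact: (ae_limn_esup_gt mT cons erg dc' (subset_closure Gr) r0).
Qed.
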